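(* For every positive integer $n$ and every edge $e$ of the complete graph $K_{2n+1}$, $def(K_{2n+1}-e)=n-1$.
   Context: All graphs are finite, undirected, without loops or multiple edges. A proper $t$-edge-coloring of $G$ is a map $\alpha:E(G)\to\{1,\ldots,t\}$ such that all $t$ colors are used and adjacent edges receive different colors. The spectrum $S(v,\alpha)$ of a vertex $v$ is the set of colors on edges incident to $v$. For a finite set $A$ of integers, $def(A)=\max A-\min A-|A|+1$. Define $def(v,\alpha)=def(S(v,\alpha))$, $def(G,\alpha)=\sum_{v\in V(G)}def(v,\alpha)$, and $def(G)=\min_\alpha def(G,\alpha)$ over all proper edge-colorings $\alpha$ of $G$. $K_{2n+1}-e$ denotes the complete graph on $2n+1$ vertices with one edge removed. *)

(* Defs.v *)
From mathcomp Require Import all_boot finmap boolp.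

Set Implicit Arguments.
Unset Strict Implicit.
Unset Printing Implicit Defensive.

Local Open Scope fset_scope.
Local Open Scope nat_scope.

Record sgraph (T : finType) := SGraph {
  edges : {set {set T}};
  edges_card2 : {in edges, forall e : {set T}, #|e| = 2}
}.

Lemma complete_card2 (T : finType) :
  {in [set e : {set T} | #|e| == 2], forall e : {set T}, #|e| = 2}.
Proof. by move=> e; rewrite inE => /eqP. Qed.

Definition complete (T : finType) : sgraph T := SGraph (@complete_card2 T).

Lemma remove_edge_card2 (T : finType) (G : sgraph T) (e : {set T}) :
  {in edges G :\ e, forall f : {set T}, #|f| = 2}.
Proof. by move=> f /setD1P[_]; exact: edges_card2. Qed.

Definition remove_edge (T : finType) (G : sgraph T) (e : {set T}) : sgraph T :=
  SGraph (@remove_edge_card2 T G e).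

(* Only the values of [a] on [edges G] are meaningful. *)
Definition proper_coloring (T : finType) (G : sgraph T) (t : nat)
    (a : {set T} -> nat) : Prop :=
  [/\ {in edges G, forall e, 1 <= a e <= t},
      forall c, 1 <= c <= t -> exists2 e, e \in edges G & a e = c
    & {in edges G &, forall e f,
        e != f -> e :&: f != set0 -> a e <> a f}].

Definition spectrum (T : finType) (G : sgraph T) (v : T) (a : {set T} -> nat) :
    {fset nat} :=
  [fset a e | e in [set e in edges G | v \in e]].

Definition fset_max (A : {fset nat}) : nat := \max_(i <- A) i.

(* The default value [fset_max A] is harmless: it is at least every element of
   [A]. *)
Definition fset_min (A : {fset nat}) : nat := \big[minn/fset_max A]_(i <- A) i.

(* max A - min A - |A| + 1; grouped in this way the subtractions of [nat] never
   truncate for nonempty [A], and the empty set (spectrum of an isolated vertex)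
   gets deficiency 0. *)
Definition set_def (A : {fset nat}) : nat :=
  (fset_max A - fset_min A) - (#|` A| - 1).

Definition coloring_def (T : finType) (G : sgraph T) (a : {set T} -> nat) : nat :=
  \sum_(v : T) set_def (spectrum G v a).

Definition attained_def (T : finType) (G : sgraph T) (k : nat) : Prop :=
  exists t a, proper_coloring G t a /\ coloring_def G a = k.

Lemma attained_def_ex (T : finType) (G : sgraph T) :
  exists k, `[< attained_def G k >].
Proof.
pose a (e : {set T}) := (index e (enum (edges G))).+1.
exists (coloring_def G a); apply/asboolP; exists #|edges G|, a; split=> //.
split=> [e eG|[//|c] /= ltc|e f eG fG neq_ef _ [eq_ef]].
- by rewrite /a /= cardE index_mem mem_enum.
- have s_c : c < size (enum (edges G)) by rewrite -cardE.
  exists (nth set0 (enum (edges G)) c); first by rewrite -mem_enum mem_nth.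
  by rewrite /a index_uniq ?enum_uniq.
- by case/eqP: neq_ef; apply: (index_inj set0 _ _ eq_ef); rewrite mem_enum.
Qed.

Definition deficiency (T : finType) (G : sgraph T) : nat :=
  ex_minn (attained_def_ex G).

(* Main.v *)
(* Lower bound: each color class has an even number of incidences, so for every
   residue r mod 2n the number of pairs (v, c) with c = r mod 2n a color seen by
   v is even. As there are 2n + 1 vertices, some vertex sees r an even number of
   times. A vertex of degree d and deficiency k sees at most 2 k + 2n - d
   residues an even number of times, since its spectrum differs from an interval
   of length 2n in at most that many colors. Summing over the vertices gives
   2n <= 2 def + 2.
   Upper bound: an explicit coloring in which all spectra are intervals, except
   one whose n - 1 missing colors are consecutive. *)

Require Import Defs.
From mathcomp Require Import all_boot.
From mathcomp Require Import fingroup perm finmap boolp zify.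

Set Implicit Arguments.
Unset Strict Implicit.
Unset Printing Implicit Defensive.

(** * Residues hit an even number of times *)

Lemma card_inj_itv (F : finType) (D : {set F}) (a : F -> nat) (l h : nat) :
  {in D &, injective a} -> {in D, forall x, l <= a x < h} -> #|D| <= h - l.
Proof.
move=> aI aD.
have -> : #|D| = size [seq a x | x <- enum D] by rewrite size_map -cardE.
rewrite -(size_iota l (h - l)); apply: uniq_leq_size.
  by rewrite map_inj_in_uniq ?enum_uniq // => x y; rewrite !mem_enum; exact: aI.
move=> c /mapP[x xD ->]; have /aD : x \in D by rewrite -mem_enum.
by rewrite mem_iota; lia.
Qed.

Lemma modn_inj_window (m N p q : nat) :
  p = q %[mod N] -> m <= p < m + N -> m <= q < m + N -> p = q.
Proof.
wlog le_qp : p q / q <= p => [IH eq_pq pm qm|eq_pq pm qm].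
  by have [le|/ltnW le] := leqP q p; [|symmetry]; apply: IH.
have : N %| p - q by rewrite -eqn_mod_dvd //; apply/eqP.
by case: (posnP (p - q)) => [|p_gt_q /(dvdn_leq p_gt_q)]; lia.
Qed.

(* A residue hit an even number of times is either missed by [a] on the window
   [m, m + N[, or hit by [a] outside this window. *)
Lemma card_even_residues (F : finType) (D : {set F}) (a : F -> nat)
    (m M N : nat) :
  0 < N -> {in D &, injective a} -> {in D, forall x, m <= a x <= M} ->
  #|D| <= N ->
  #|[set r : 'I_N | ~~ odd #|[set x in D | a x %% N == r]|]|
    <= 2 * (M - m - (#|D| - 1)) + (N - #|D|).
Proof.
move=> N_gt0 aI aD leDN.
pose res x := Ordinal (ltn_pmod (a x) N_gt0).
pose D1 := [set x in D | a x < m + N].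
pose D2 := [set x in D | m + N <= a x].
have D12 : #|D| = #|D1| + #|D2|.
  rewrite -(cardsID [set x | a x < m + N] D); congr (_ + _); apply: eq_card=> x;
    by rewrite !inE -?leqNgt // andbC.
have leD2 : #|D2| <= M.+1 - (m + N).
  apply: (@card_inj_itv _ _ a) => [x y|x].
    by rewrite !inE => /andP[xD _] /andP[yD _]; exact: aI.
  by rewrite inE => /andP[/aD]; lia.
have cD1 : #|res @: D1| = #|D1|.
  apply: card_in_imset => x y; rewrite !inE => /andP[xD ltx] /andP[yD lty].
  move=> /(congr1 val) /= eq_r; apply: aI => //.
  have /andP[m_x _] := aD _ xD; have /andP[m_y _] := aD _ yD.
  by apply: (modn_inj_window (m := m) eq_r); apply/andP.
have leE : #|[set r : 'I_N | ~~ odd #|[set x in D | a x %% N == r]|]|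
    <= #|~: (res @: D1) :|: res @: D2|.
  apply/subset_leq_card/subsetP => r; rewrite !inE => evr.
  (* A nonzero even number of hits is at least two; as [res] is injective on [D1], a second hit [y]
     must lie in [D2]. *)
  have [rD1|//] := boolP (r \in res @: D1); apply/imsetP.
  have /imsetP[x xD1 def_r] := rD1.
  have xr : x \in [set x in D | a x %% N == r].
    by move: xD1; rewrite def_r !inE /= eqxx => /andP[->].
  have : 0 < #|[set x in D | a x %% N == r] :\ x|.
    by move: evr; rewrite (cardsD1 x) xr; case: #|_|.
  case/card_gt0P => y; rewrite !inE => /and3P[neq_yx yD /eqP yr].
  exists y; last by apply: val_inj.
  rewrite inE yD leqNgt; apply: contra neq_yx => lty; apply/eqP.
  have /imset_injP resI : #|res @: D1| == #|D1| by rewrite cD1.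
  apply: resI => //; first by rewrite inE yD.
  by rewrite -def_r; apply: val_inj.
have leU : #|~: (res @: D1) :|: res @: D2| <= N - #|D1| + #|D2|.
  apply: leq_trans (leq_card_setU _ _) _.
  by rewrite leq_add ?leq_imset_card // cardsCs setCK card_ord cD1.
(* By [D12], the bound of [leU] equals [(N - #|D|) + 2 * #|D2|]. *)
apply: leq_trans leE (leq_trans leU _).
have [D20|[x]] := set_0Vmem D2.
  by move: D12; rewrite D20 cards0; lia.
rewrite inE => /andP[/aD]; lia.
Qed.

(** * Incident edges and spectra *)

Definition incident (T : finType) (G : sgraph T) (v : T) : {set {set T}} :=
  [set e in edges G | v \in e].

Lemma bigmin_leq_seq (d : nat) (s : seq nat) (c : nat) :
  c \in s -> \big[minn/d]_(i <- s) i <= c.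
Proof.
elim: s => // b s IHs; rewrite inE big_cons geq_min.
by case/predU1P => [->|/IHs ->]; rewrite ?leqnn ?orbT.
Qed.

Section SpectrumDef.

Variables (T : finType) (G : sgraph T) (a : {set T} -> nat) (v : T).

Let mem_spectrum e : e \in incident G v -> a e \in spectrum G v a.
Proof. by move=> ev; apply: in_imfset. Qed.

Lemma spectrum_bounds : {in incident G v, forall e,
  fset_min (spectrum G v a) <= a e <= fset_max (spectrum G v a)}.
Proof.
move=> e /mem_spectrum; rewrite /fset_max /fset_min => eS.
by rewrite (@leq_bigmax_seq _ _ xpredT id) // bigmin_leq_seq.
Qed.

Hypothesis aI : {in incident G v &, injective a}.

Lemma card_spectrum : #|` spectrum G v a| = #|incident G v|.
Proof. by rewrite card_in_imfset //= -cardE. Qed.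

Lemma set_def_spectrum_le (l h : nat) :
  0 < #|incident G v| -> {in incident G v, forall e, l <= a e <= h} ->
  set_def (spectrum G v a) <= h - l - (#|incident G v| - 1).
Proof.
case/card_gt0P => e0 e0v alh; rewrite /set_def card_spectrum.
have alhS c : c \in spectrum G v a -> l <= c <= h.
  by case/imfsetP => e ev ->; apply: alh.
apply/leq_sub2r/leq_sub.
  by apply/bigmax_leqP_seq => c /alhS /andP[].
(* [fset_max] is the default value inside [fset_min], so it too must be at least [l]; the edge [e0]
   ensures this. *)
have lem : l <= fset_max (spectrum G v a).
  have /andP[_] := spectrum_bounds e0v; apply: leq_trans.
  by have /andP[] := alh _ e0v.
rewrite /fset_min big_seq; elim/big_ind: _ => // [x y|c /alhS /andP[]//].
by rewrite leq_min => -> ->.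
Qed.

End SpectrumDef.

Lemma proper_incident_inj (T : finType) (G : sgraph T) (t : nat)
    (a : {set T} -> nat) (v : T) :
  proper_coloring G t a -> {in incident G v &, injective a}.
Proof.
case=> _ _ aP e f; rewrite !inE => /andP[eG ve] /andP[fG vf] eq_a.
apply/eqP; apply: contraT => neq_ef; case: (aP e f eG fG neq_ef _ eq_a).
by apply/set0Pn; exists v; rewrite in_setI ve.
Qed.

Lemma incident_completeE (T : finType) (v : T) :
  incident (complete T) v = [set [set v; w] | w in [set~ v]].
Proof.
apply/setP => e; rewrite !inE; apply/andP/imsetP.
  case=> /cards2P[x [y [neq_xy ->]]] /set2P[] ->; [exists y|exists x] => //.
  - by rewrite !inE eq_sym.
  - by rewrite !inE.
  - by rewrite setUC.
case=> w; rewrite !inE => neq_wv ->.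
by rewrite cards2 (eq_sym v) neq_wv set21.
Qed.

Lemma card_incident_complete (T : finType) (v : T) :
  #|incident (complete T) v| = #|T| - 1.
Proof.
rewrite incident_completeE card_in_imset => [|w1 w2].
  by rewrite cardsC1 subn1.
rewrite !inE => w1v w2v /setP/(_ w1); rewrite !inE eqxx orbT (negPf w1v) /=.
by move/esym/eqP.
Qed.

Lemma card_incident_remove (T : finType) (e : {set T}) (v : T) :
  e \in edges (complete T) ->
  #|incident (remove_edge (complete T) e) v| = #|T| - 1 - (v \in e).
Proof.
move=> eK; rewrite -(card_incident_complete v).
have -> : incident (remove_edge (complete T) e) v = incident (complete T) v :\ e.
  by apply/setP => f; rewrite !inE andbA.
by rewrite [in RHS](cardsD1 e) inE eK addKn.
Qed.

(** * Lower bound by parity *)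

Lemma handshake (T : finType) (E : {set {set T}}) :
  \sum_(v : T) #|[set e in E | v \in e]| = \sum_(e in E) #|e|.
Proof.
under eq_bigr => v _ do rewrite -sum1_card.
under [RHS]eq_bigr => e _ do rewrite -sum1_card.
rewrite [RHS](exchange_big_dep predT) //=.
by apply: eq_bigr => v _; apply: eq_bigl => e; rewrite inE.
Qed.

Lemma odd_sum_all (I : finType) (F : I -> nat) :
  (forall i, odd (F i)) -> odd (\sum_i F i) = odd #|I|.
Proof.
move=> oddF; rewrite -sum1_card.
elim/big_ind2: _ => // [m1 m2 n1 n2|i _]; last exact: oddF.
by rewrite !oddD => -> ->.
Qed.

Lemma coloring_def_ge (T : finType) (n : nat) (e : {set T}) (t : nat)
    (a : {set T} -> nat) :
  0 < n -> #|T| = 2 * n + 1 -> e \in edges (complete T) ->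
  proper_coloring (remove_edge (complete T) e) t a ->
  n - 1 <= coloring_def (remove_edge (complete T) e) a.
Proof.
set G := remove_edge _ e; move=> n_gt0 cT eK aP.
have N_gt0 : 0 < 2 * n by lia.
pose ev v (r : 'I_(2 * n)) :=
  ~~ odd #|[set f in incident G v | a f %% (2 * n) == r]|.
have ev_ex r : exists v, ev v r.
  apply/existsP/contraT; rewrite negb_exists => /forallP odd_r.
  pose Er := [set f in edges G | a f %% (2 * n) == r].
  (* If all [2 * n + 1] vertices saw [r] an odd number of times, this sum would be odd; by
     [handshake] it is [2 * #|Er|]. *)
  have: odd (\sum_v #|[set f in Er | v \in f]|).
    rewrite odd_sum_all ?cT => [|v]; first by rewrite addn1 mul2n /= odd_double.
    have := odd_r v; rewrite negbK; congr (odd _); apply: eq_card => f.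
    by rewrite !inE andbAC.
  rewrite handshake (eq_bigr (fun=> 2)) => [|f]; last first.
    by rewrite inE => /andP[/edges_card2].
  by rewrite sum_nat_const muln2 odd_double.
have le1 : 2 * n <= \sum_v #|[set r | ev v r]|.
  under eq_bigr => v _ do rewrite -sum1_card.
  rewrite (exchange_big_dep predT) //= -[X in X <= _]card_ord -sum1_card.
  apply: leq_sum => r _; rewrite sum1_card; have [v vr] := ev_ex r.
  have {}vr : r \in [set r | ev v r] by rewrite inE.
  by apply/card_gt0P; exists v.
(* The degree of [v] falls short of the modulus [2 * n] by exactly [v \in e]. *)
have le2 v : #|[set r | ev v r]| <=
    2 * set_def (spectrum G v a) + (v \in e).
  have aI := proper_incident_inj (v := v) aP.
  have cv := card_incident_remove v eK.
  have := card_even_residues N_gt0 aI (@spectrum_bounds _ G a v).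
  rewrite /set_def (card_spectrum aI) cv cT; move/(_ _)/leq_trans; apply; lia.
have : 2 * n <= 2 * coloring_def G a + 2.
  apply: leq_trans le1 (leq_trans (leq_sum _ (fun v _ => le2 v)) _).
  rewrite big_split -big_distrr leq_add2l /=.
  (* The terms [v \in e] add up to [#|e| = 2]. *)
  by rewrite -(@complete_card2 T e) // -sum1_card [leqRHS]big_mkcond.
lia.
Qed.

(** * A coloring of deficiency n - 1 *)

(* The vertices are x_0, ..., x_(n-1), coded by 0, ..., n - 1, then
   y_1, ..., y_n, coded by n, ..., 2 n - 1, and z, coded by 2 n; the removed edge
   is x_0 y_n. Colors start at 0.
   The edges x_i x_j, y_i y_j and x_i y_i get color i + j, shifted by n - 1 when
   i + j >= n, which frees the colors n, ..., 2 n - 2; these are given to the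
   edges x_i y_j with i <> j by a cyclic Latin square. At this point the colors
   used at each vertex form an interval, except that y_n misses 2 n - 1. Then z
   is joined to y_n by that color, and to every other vertex by the color just
   below or just above the interval, so that z misses exactly n, ..., 2 n - 2. *)
Definition band (n s : nat) : nat := if s < n then s else s + n - 1.

(* Only meaningful for p < q and (p, q) <> (0, 2 n - 1). *)
Definition color_lt (n p q : nat) : nat :=
  if q < n then band n (p + q)
  else if q < 2 * n then
    let j := q + 1 - n in
    if n <= p then band n (p + 1 - n + j)
    else if p == j then band n (p + j)
    else if p < j then n - 1 + (j - p) else 2 * n - 1 + j - p
  else if p == 0 then 0
  else if p < n then p + 2 * n - 1
  else if p + 1 - n < n then p + 1 - n
  else 2 * n - 1.

Definition color (n p q : nat) : nat :=
  if p < q then color_lt n p q else color_lt n q p.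

Definition removed_pair (n p q : nat) : bool := (p == 0) && (q == 2 * n - 1).

(** Together with [color_max], the ends of the interval allotted to [p]. It has as many colors as
    the degree of [p], namely 2 n - 1 at x_0 and y_n and 2 n elsewhere, except at z, where it has n
    - 1 more. *)
Definition color_min (n p : nat) : nat :=
  if p < n then p else if p < 2 * n then p + 1 - n else 0.

Definition color_max (n p : nat) : nat :=
  if p == 0 then 2 * n - 2
  else if (p == 2 * n - 1) || (p == 2 * n) then 3 * n - 2
  else color_min n p + 2 * n - 1.

Lemma color_bounds n p q : 0 < n -> p < 2 * n + 1 -> q < 2 * n + 1 -> p != q ->
  ~~ removed_pair n p q -> ~~ removed_pair n q p ->
  color_min n p <= color n p q <= color_max n p.
Proof.
move=> n0 pn qn pq; rewrite /removed_pair /color_max /color_min.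
rewrite /color /color_lt /band => s1 s2.
by repeat (case: ifP => ?); lia.
Qed.

Lemma color_inj n p q r : color n p q = color n p r ->
  0 < n -> p < 2 * n + 1 -> q < 2 * n + 1 -> r < 2 * n + 1 ->
  p != q -> p != r ->
  ~~ removed_pair n p q -> ~~ removed_pair n q p ->
  ~~ removed_pair n p r -> ~~ removed_pair n r p -> q = r.
Proof.
wlog lt_qr : q r / q < r => [IH eq_c|/eqP].
  have [lt|lt|//] := ltngtP q r; first exact: IH.
  by move=> *; symmetry; apply: IH.
move=> eq_c n_gt0 pn qn rn pq pr s1 s2 s3 s4.
suff /negP[] : color n p q != color n p r by [].
rewrite /removed_pair in s1 s2 s3 s4; rewrite /color /color_lt /band; clear eq_c.
by repeat (case: ifP => ?; try (exfalso; lia)); lia.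
Qed.

Lemma color_surj (n c : nat) : 0 < n -> c < 3 * n - 1 -> exists p q,
  [/\ p < q < 2 * n + 1, ~~ removed_pair n p q, ~~ removed_pair n q p
    & color n p q = c].
Proof.
move=> n_gt0 ltc.
(* The edges are, in order: x_0 z, x_0 x_c, x_0 y_(c+1-n), y_n z, and y_(c+1-2n) y_n. *)
pose pq := if c == 0 then (0, 2 * n) else if c < n then (0, c)
  else if c < 2 * n - 1 then (0, c) else if c == 2 * n - 1 then (2 * n - 1, 2 * n)
  else (c - n, 2 * n - 1).
exists pq.1, pq.2; rewrite {}/pq; repeat (case: ifP => /= ?);
  rewrite /removed_pair /color /color_lt /band; split;
  repeat (case: ifP => ?); lia.
Qed.

(** * Transport of the coloring to an arbitrary removed edge *)

Lemma perm_pair_ex (T : finType) (u v x y : T) :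
  u != v -> x != y -> exists s : {perm T}, s u = x /\ s v = y.
Proof.
move=> neq_uv neq_xy; pose w := tperm u x v.
have neq_wx : w != x by rewrite -(tpermL u x) (inj_eq perm_inj) eq_sym.
(* The first transposition sends [u] to [x] and [v] to [w]; the second fixes [x] and sends [w] to
   [y]. *)
exists (tperm u x * tperm w y)%g; rewrite !permM tpermL tpermL; split=> //.
by rewrite tpermD // eq_sym.
Qed.

Lemma eq_set2 (T : finType) (x y p q : T) :
  [set x; y] = [set p; q] -> p != q -> x = p /\ y = q \/ x = q /\ y = p.
Proof.
move=> eq_e neq_pq.
have xpq : x \in [set p; q] by rewrite -eq_e set21.
have ypq : y \in [set p; q] by rewrite -eq_e set22.
have : p \in [set x; y] by rewrite eq_e set21.
have : q \in [set x; y] by rewrite eq_e set22.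
case/set2P: xpq => ->; case/set2P: ypq => ->; [|by left|by right|];
  by rewrite !inE ?orbb ?(eq_sym q p) (negPf neq_pq).
Qed.

(** [pick] may return either orientation of an edge; symmetry of [c] makes the value independent of
    it. *)
Lemma edge_fun_ex (T : finType) (c : T -> T -> nat) :
  (forall p q, c p q = c q p) ->
  exists a : {set T} -> nat, forall p q, p != q -> a [set p; q] = c p q.
Proof.
move=> cC.
exists (fun e => if [pick pq | e == [set pq.1; pq.2]] is Some pq
                 then c pq.1 pq.2 else 0) => p q neq_pq.
case: pickP => [[x y] /= /eqP eq_e|/(_ (p, q))]; last by rewrite eqxx.
by move/esym/eq_set2/(_ neq_pq): eq_e => [[-> ->]|[-> ->]].
Qed.

Lemma coloring_def_le (n : nat) (e : {set 'I_(2 * n + 1)}) :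
  0 < n -> e \in edges (complete 'I_(2 * n + 1)) -> exists t a,
  proper_coloring (remove_edge (complete 'I_(2 * n + 1)) e) t a /\
  coloring_def (remove_edge (complete 'I_(2 * n + 1)) e) a <= n - 1.
Proof.
set T := 'I_(2 * n + 1); set G := remove_edge _ e => n_gt0 eK.
have /cards2P[u [v [neq_uv def_e]]] : #|e| == 2 by move: eK; rewrite inE.
have lt0 : 0 < 2 * n + 1 by lia.
have lty : 2 * n - 1 < 2 * n + 1 by lia.
have ltz : 2 * n < 2 * n + 1 by lia.
have neq_xy : Ordinal lt0 != Ordinal lty by rewrite -val_eqE /=; lia.
have [s [su sv]] := perm_pair_ex neq_uv neq_xy.
have colorC p q : color n p q = color n q p.
  by rewrite /color; case: (ltngtP p q) => // ->.
(* The values of [color] start at 0, the colors of a proper coloring at 1. As [s] maps the ends of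
   [e] to x_0 and y_n, the removed edges correspond. *)
have [|a aE] := @edge_fun_ex T (fun p q => (color n (s p) (s q)).+1).
  by move=> p q; rewrite colorC.
have sval_eq p q : (s p == s q :> nat) = (p == q).
  by rewrite val_eqE (inj_eq perm_inj).
have s0 x : (s x == 0 :> nat) = (x == u) by rewrite -sval_eq su.
have sy x : (s x == 2 * n - 1 :> nat) = (x == v) by rewrite -sval_eq sv.
have edgeE p q : ([set p; q] \in edges G) =
    [&& p != q, ~~ removed_pair n (s p) (s q) & ~~ removed_pair n (s q) (s p)].
  rewrite !inE cards2 /removed_pair !s0 !sy def_e.
  have [->|neq_pq] := eqVneq p q; first by rewrite andbF.
  rewrite andbT -negb_or /=; congr (~~ _); apply/eqP/orP => [eq_pq|].
    by case: (eq_set2 eq_pq neq_uv) => -[-> ->]; rewrite !eqxx; [left|right].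
  by case=> /andP[/eqP -> /eqP ->] //; rewrite setUC.
have incP x f : f \in incident G x -> exists2 y, f = [set x; y] &
    [&& x != y, ~~ removed_pair n (s x) (s y) & ~~ removed_pair n (s y) (s x)].
  rewrite inE => /andP[fG xf].
  have : f \in incident (complete T) x.
    by move: fG; rewrite !inE xf => /andP[_ ->].
  rewrite incident_completeE => /imsetP[y _ def_f].
  by exists y => //; rewrite -edgeE -def_f.
have aI x : {in incident G x &, injective a}.
  move=> _ _ /incP[y -> /and3P[xy s1 s2]] /incP[z -> /and3P[xz s3 s4]].
  rewrite !aE // => -[/color_inj eq_yz]; congr [set _; _].
  by apply/eqP; rewrite -sval_eq; apply/eqP/eq_yz;
    rewrite ?ltn_ord ?sval_eq.
have a_bounds x : {in incident G x, forall f,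
    (color_min n (s x)).+1 <= a f <= (color_max n (s x)).+1}.
  move=> _ /incP[y -> /and3P[xy s1 s2]]; rewrite aE // !ltnS.
  by apply: color_bounds; rewrite ?ltn_ord ?sval_eq.
have inc_ex f : f \in edges G -> exists x, f \in incident G x.
  move=> fG; have /card_gt0P[x xf] : 0 < #|f| by rewrite (edges_card2 fG).
  by exists x; rewrite inE fG.
exists (3 * n - 1), a; split.
  split=> [f /inc_ex[x] fx|[//|c] ltc|f g fG gG neq_fg /set0Pn[x] xfg eq_a].
  - have := a_bounds _ _ fx; rewrite /color_max /color_min.
    have := ltn_ord (s x); repeat case: ifP => ?; lia.
  - have [p [q [/andP[ltpq ltq] s1 s2 <-]]] := color_surj n_gt0 ltc.
    have ltp := ltn_trans ltpq ltq.
    pose x := s^-1%g (Ordinal ltp); pose y := s^-1%g (Ordinal ltq).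
    have xp : s x = p :> nat by rewrite permKV.
    have yq : s y = q :> nat by rewrite permKV.
    have neq_xy' : x != y by rewrite -sval_eq xp yq; lia.
    by exists [set x; y]; rewrite ?edgeE ?aE // xp yq // s1 s2 neq_xy'.
  - case/setIP: xfg => xf xg; case/eqP: neq_fg.
    by apply: (aI x) => //; rewrite inE ?fG ?gG.
have in_e x : (x \in e) = (s x == 0 :> nat) || (s x == 2 * n - 1 :> nat).
  by rewrite s0 sy def_e !inE.
have def_le x :
    set_def (spectrum G x a)
      <= color_max n (s x) - color_min n (s x) - (2 * n - 1 - (x \in e)).
  have cx := card_incident_remove x eK; rewrite card_ord addnK in cx.
  apply: leq_trans (set_def_spectrum_le (@aI x) _ (@a_bounds x)) _; rewrite cx.
    by case: (x \in e); lia.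
  by rewrite subSS leq_sub2l //; case: (x \in e); lia.
(* Only the vertex sent to z contributes: 3 n - 1 allotted colors against degree 2 n. *)
rewrite /coloring_def (bigD1 (s^-1%g (Ordinal ltz))) //= big1 => [|x neq_xz].
  rewrite addn0; apply: leq_trans (def_le _) _.
  rewrite in_e permKV /color_max /color_min /=.
  repeat (case: ifP => ? /=); lia.
have neq_sxz : s x != 2 * n :> nat.
  by apply: contra neq_xz => /eqP sx; rewrite -(inj_eq (@perm_inj _ s)) permKV
    -val_eqE /= sx.
apply/eqP; rewrite -leqn0; apply: leq_trans (def_le x) _.
rewrite in_e /color_max /color_min; have := ltn_ord (s x).
by repeat (case: ifP => ? /=); lia.
Qed.

Theorem theorem3p2 (n : nat) (n_gt0 : 0 < n)
    (e : {set 'I_(2 * n + 1)}) (eK : e \in edges (complete 'I_(2 * n + 1))) :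
  deficiency (remove_edge (complete 'I_(2 * n + 1)) e) = n - 1.
Proof.
rewrite /deficiency; case: ex_minnP => k /asboolP[t [a [aP <-]]] k_min.
have [t' [a' [aP' le_a']]] := coloring_def_le n_gt0 eK.
apply/eqP; rewrite eqn_leq (coloring_def_ge n_gt0 _ eK aP) ?card_ord // andbT.
by apply: leq_trans (k_min _ _) le_a'; apply/asboolP; exists t', a'.
Qed.
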